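(* Let $n\ge m\ge 2$. Then $$\mu_{\rm d}(P_n\,\square\,P_m)=\begin{cases}3, & n=m=2,\\ 4, & (n,m)=(3,3)\ \text{or}\ (n\ge 3\ \text{and}\ m=2),\\ 5, & \text{otherwise}.\end{cases}$$
   Context: The grid graph $P_n\,\square\,P_m$ has vertex set $[n]\times[m]$, with $(i,j)$ adjacent to $(k,\ell)$ iff $|i-k|+|j-\ell|=1$. For a graph $G$ and $X\subseteq V(G)$, vertices $u,v\in V(G)$ are $X$-visible if there exists a shortest $u,v$-path $P$ with $V(P)\cap X\subseteq\{u,v\}$. $X$ is a dual mutual-visibility set if every two vertices of $X$ are $X$-visible and every two vertices of $V(G)\setminus X$ are $X$-visible; $\mu_{\rm d}(G)$ is the maximum cardinality of a dual mutual-visibility set of $G$. *)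

(* Defs.v *)
From mathcomp Require Import all_boot all_order all_algebra.
From mathcomp Require Import boolp.

Set Implicit Arguments.
Unset Strict Implicit.
Unset Printing Implicit Defensive.

(* A graph on the vertex set T is given by its adjacency relation e. As in
   path.v, a walk is a start vertex u with the sequence p of the vertices that
   follow it, so its length is [size p] and its vertex set is u :: p. *)

Definition shortest_path (T : finType) (e : rel T) (u v : T) (p : seq T) :=
  [/\ path e u p, last u p = v &
      forall q : seq T, path e u q -> last u q = v -> size p <= size q].

Definition visible (T : finType) (e : rel T) (X : {set T}) (u v : T) :=
  exists p : seq T, shortest_path e u v p /\
    forall w : T, w \in u :: p -> w \in X -> w = u \/ w = v.

Definition dual_mutual_visibility (T : finType) (e : rel T) (X : {set T}) :=
  (forall u v : T, u \in X -> v \in X -> visible e X u v) /\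
  (forall u v : T, u \notin X -> v \notin X -> visible e X u v).

Definition mu_d (T : finType) (e : rel T) : nat :=
  \max_(X : {set T} | `[< dual_mutual_visibility e X >]) #|X|.

(* P_n [] P_m, with vertices numbered from 0. *)
Definition grid (n m : nat) : rel ('I_n * 'I_m) :=
  fun x y => `|x.1 - y.1|%N + `|x.2 - y.2|%N == 1.

Lemma grid_sym (n m : nat) : symmetric (@grid n m).
Proof. by move=> x y; rewrite /grid distnC [X in _ + X]distnC. Qed.

Lemma grid_irr (n m : nat) : irreflexive (@grid n m).
Proof. by move=> x; rewrite /grid !distnn. Qed.

(* Main.v *)
Require Import Defs.
From mathcomp Require Import all_boot all_order all_algebra.
From mathcomp Require Import boolp.
From mathcomp Require Import zify.

(* On a line of the grid (a row or a column) the shortest path is unique, so no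
   vertex of [X] lies between two vertices of [X] or between two vertices of the
   complement. Hence a line has at most two vertices in [X], and on a line with
   at least four vertices each of them is an end, or is next to an end that also
   lies in [X]. Moreover, a corner with both neighbours in [X] is visible from
   no other vertex of its own class. So in a large grid [X] consists of corners
   and neighbours of corners, and a count over the four sides gives the bound 5;
   this value is attained by (0,0), (1,0), (0,m-1), (n-1,m-1), (n-1,m-2). For
   m = 2 and for the 3 x 3 grid the same constraints leave at most 4 vertices,
   as in the set of the four corners. *)

Set Implicit Arguments.
Unset Strict Implicit.
Unset Printing Implicit Defensive.

(** * Distance in the grid and visibility by greedy walks *)

Definition grid_dist (n m : nat) (u v : 'I_n * 'I_m) : nat :=
  `|u.1 - v.1|%N + `|u.2 - v.2|%N.

Lemma grid_dist_eq0 (n m : nat) (u v : 'I_n * 'I_m) :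
  grid_dist u v = 0 -> u = v.
Proof.
case: u v => [a b] [c d]; rewrite /grid_dist /= => h.
by congr pair; apply: val_inj => /=; lia.
Qed.

Lemma grid_dist_le_size (n m : nat) (u : 'I_n * 'I_m) (p : seq ('I_n * 'I_m)) :
  path (@grid n m) u p -> grid_dist u (last u p) <= size p.
Proof.
elim: p u => [|w p IH] u /=; first by rewrite /grid_dist; lia.
by case/andP=> + /IH; rewrite /grid /grid_dist => /eqP; lia.
Qed.

(* [B] collects the pairs that may be invisible: the greedy walk towards the
   target has to stay outside [B] and outside [X] until it arrives. *)
Lemma visible_greedy (n m : nat) (X : {set 'I_n * 'I_m})
    (B : rel ('I_n * 'I_m)) :
  (forall u v, u != v -> ~~ B u v ->
     exists w, [/\ grid u w, grid_dist w v < grid_dist u v &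
                   w = v \/ w \notin X /\ ~~ B w v]) ->
  forall u v, ~~ B u v ->
  exists p, [/\ path (@grid n m) u p, last u p = v,
                size p = grid_dist u v &
                forall w, w \in p -> w \in X -> w = v].
Proof.
move=> step u v; have [k] := ubnP (grid_dist u v).
elim: k u => // k IH u lek nB.
have [->|neq] := eqVneq u v.
  by exists [::]; split=> //; rewrite /grid_dist !distnn.
have [w [uw lt_wv hw]] := step u v neq nB.
have du : grid_dist u v <= (grid_dist w v).+1.
  by move: uw; rewrite /grid /grid_dist => /eqP; lia.
case: hw => [wv|[wX nBw]].
  exists [:: w]; split=> /=; rewrite ?uw //.
    by move: lt_wv du; rewrite wv /grid_dist !distnn; lia.
  by move=> z; rewrite inE => /eqP ->.
have [|p [pp lp sp hp]] := IH w _ nBw; first by lia.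
exists (w :: p); split=> /=; rewrite ?uw ?pp //; first by lia.
move=> z; rewrite inE => /orP [/eqP ->|]; last exact: hp.
by rewrite (negbTE wX).
Qed.

(** The greedy walk has length [grid_dist u v], a lower bound for every walk from [u] to [v], so it
    is a shortest path. *)
Lemma visible_of_greedy (n m : nat) (X : {set 'I_n * 'I_m})
    (B : rel ('I_n * 'I_m)) :
  (forall u v, u != v -> ~~ B u v ->
     exists w, [/\ grid u w, grid_dist w v < grid_dist u v &
                   w = v \/ w \notin X /\ ~~ B w v]) ->
  forall u v, ~~ B u v -> visible (@grid n m) X u v.
Proof.
move=> step u v nB; have [p [pp lp sp hp]] := visible_greedy step nB.
exists p; split.
  by split=> // q pq lq; rewrite sp -lq; apply: grid_dist_le_size.
move=> w; rewrite inE => /orP [/eqP -> _|wp wX]; first by left.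
by right; apply: hp.
Qed.

Lemma ord_lift (n a : nat) : a < n -> exists i : 'I_n, i = a :> nat.
Proof. by move=> lt_an; exists (Ordinal lt_an). Qed.

(** Transfer to natural-number coordinates, so that the step hypothesis becomes linear
    arithmetic. *)
Lemma visible_of_greedy_nat (n m : nat) (x : nat -> nat -> bool)
    (B : nat -> nat -> nat -> nat -> bool) (X : {set 'I_n * 'I_m}) :
  (forall u : 'I_n * 'I_m, (u \in X) = x u.1 u.2) ->
  (forall a b c d, a < n -> b < m -> c < n -> d < m ->
     (a, b) <> (c, d) -> ~~ B a b c d ->
     exists a' b', [/\ a' < n, b' < m, `|a - a'|%N + `|b - b'|%N = 1,
        `|a' - c|%N + `|b' - d|%N < `|a - c|%N + `|b - d|%N &
        (a' = c /\ b' = d) \/ ~~ x a' b' && ~~ B a' b' c d]) ->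
  forall u v : 'I_n * 'I_m, ~~ B u.1 u.2 v.1 v.2 -> visible (@grid n m) X u v.
Proof.
move=> Xx step u v; pose B' (u v : 'I_n * 'I_m) := B u.1 u.2 v.1 v.2.
apply: (@visible_of_greedy n m X B') => {u v} -[a b] [c d] neq nB.
case: (step a b c d) => //.
  by case=> ac bd; case/eqP: neq; congr pair; apply: val_inj.
move=> a' [b' [/ord_lift [i <-] /ord_lift [j <-] adj lt hw]].
exists (i, j); split=> //; first by rewrite /grid /= adj.
case: hw => [[ic jd]|/andP [nx nB']]; last by right; rewrite Xx.
by left; congr pair; apply: val_inj.
Qed.

(** With [X] and [B] empty nothing obstructs the greedy walk, which adjusts the first coordinate and
    then the second. *)
Lemma grid_geodesic (n m : nat) (u v : 'I_n * 'I_m) :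
  exists2 p, path (@grid n m) u p /\ last u p = v & size p = grid_dist u v.
Proof.
have step (u1 v1 : 'I_n * 'I_m) : u1 != v1 -> ~~ false ->
    exists w, [/\ grid u1 w, grid_dist w v1 < grid_dist u1 v1 &
                  w = v1 \/ w \notin set0 /\ ~~ false].
  case: u1 v1 => [a b] [c d] neq _; rewrite /grid /grid_dist /=.
  case: (ltngtP a c) => [ac|ca|/val_inj ac].
  - have /ord_lift [i ia] : a.+1 < n by case: c ac {neq} => /= *; lia.
    by exists (i, b); rewrite /= ia inE; split; [apply/eqP; lia | lia | right].
  - have /ord_lift [i ia] : a.-1 < n by case: a ca {neq} => /= *; lia.
    by exists (i, b); rewrite /= ia inE; split; [apply/eqP; lia | lia | right].
  case: (ltngtP b d) => [bd|db|/val_inj bd].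
  - have /ord_lift [i ib] : b.+1 < m by case: d bd {neq} => /= *; lia.
    by exists (a, i); rewrite /= ib inE; split; [apply/eqP; lia | lia | right].
  - have /ord_lift [i ib] : b.-1 < m by case: b db {neq} => /= *; lia.
    by exists (a, i); rewrite /= ib inE; split; [apply/eqP; lia | lia | right].
  by rewrite ac bd eqxx in neq.
have [p [pp lp sp _]] :=
  @visible_greedy n m set0 (fun _ _ => false) step u v isT.
by exists p.
Qed.

(** * Vertices forced onto shortest paths *)

(** The triangle inequality in the second coordinate leaves nothing for the detour from [a] to [b]
    and back: a vertex between two vertices of a line is on that line. *)
Lemma between_collinear (a b c a' b' : nat) :
  `|a - b|%N + `|a' - b'|%N + (`|b - a|%N + `|b' - c|%N) <= `|a' - c|%N ->
  b = a.
Proof.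
by have := leqD_dist a' b' c; move: `|_ - c|%N `|_ - c|%N => e f; lia.
Qed.

(** Induction along the path: its next vertex stays on the line, and [w], if different from [u],
    lies between that vertex and the end. *)
Lemma straight_geodesic_mem (n m : nat) (p : seq ('I_n * 'I_m))
    (u w : 'I_n * 'I_m) :
  path (@grid n m) u p -> size p <= grid_dist u (last u p) ->
  u.1 = (last u p).1 \/ u.2 = (last u p).2 ->
  grid_dist u w + grid_dist w (last u p) = grid_dist u (last u p) ->
  w \in u :: p.
Proof.
elim: p u => [|u' p IH] u /=.
  move=> _ _ _; rewrite inE => h; apply/eqP/grid_dist_eq0.
  by move: h; rewrite /grid_dist; lia.
case/andP=> adj pp; have := grid_dist_le_size pp.
have [->|neq] := eqVneq w u; first by rewrite mem_head.
move: (IH u' pp); move: (last u' p) => v IHv le1 le2 line between.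
rewrite inE; apply/orP; right.
have ne : u.1 <> w.1 :> nat \/ u.2 <> w.2 :> nat.
  case: (eqVneq (u.1 : nat) w.1) => [e1|/eqP]; last by left.
  right=> e2; case/eqP: neq; case: (u) (w) e1 e2 => [a b] [c d] /= e1 e2.
  by congr pair; apply: val_inj.
(* The path has no spare length, so [u'] also lies between [u] and [v]. *)
have le3 : grid_dist u u' + grid_dist u' v <= grid_dist u v.
  by move: adj; rewrite /grid -/(grid_dist u u') => /eqP ->; lia.
move: adj le1 le2 le3 between IHv; rewrite /grid /grid_dist => /eqP.
case: line => /(congr1 val) /= h; rewrite -h distnn ?add0n ?addn0.
  move=> adj le1 le2 le3 between; have u'1 := between_collinear le3.
  have w1 : w.1 = u.1 :> nat.
    by apply: (@between_collinear _ _ v.2 u.2 w.2); rewrite between.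
  rewrite u'1 w1 !distnn !add0n in adj le1 le2 ne between *; apply.
  - by lia.
  - by left; apply: val_inj; rewrite /= u'1.
  by move: adj le1 le2 ne between; clear; lia.
move=> adj le1 le2 le3 between.
have u'2 : u'.2 = u.2 :> nat.
  by apply: (@between_collinear _ _ v.1 u.1 u'.1); lia.
have w2 : w.2 = u.2 :> nat.
  by apply: (@between_collinear _ _ v.1 u.1 w.1); lia.
rewrite u'2 w2 !distnn !addn0 in adj le1 le2 ne between *; apply.
- by lia.
- by right; apply: val_inj; rewrite /= u'2.
by move: adj le1 le2 ne between; clear; lia.
Qed.

Lemma visible_straight (n m : nat) (X : {set 'I_n * 'I_m})
    (u v w : 'I_n * 'I_m) :
  visible (@grid n m) X u v -> u.1 = v.1 \/ u.2 = v.2 ->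
  grid_dist u w + grid_dist w v = grid_dist u v ->
  w <> u -> w <> v -> w \notin X.
Proof.
case=> p [[pp lp minp] hX] line between wu wv.
(* Comparison with [q] shows that the shortest path [p] has size at most [grid_dist u v]. *)
have [q [pq lq] sq] := grid_geodesic u v.
have wp : w \in u :: p.
  by apply: straight_geodesic_mem; rewrite ?lp // -sq minp.
by apply/negP => wX; case: (hX w wp wX).
Qed.

(** The first step of a path from [u] enters [X], which is allowed only at an endpoint; it is not
    [u], so it is [v]. *)
Lemma visible_enclosed {T : finType} (e : rel T) (X : {set T}) (u v : T) :
  (forall w, e u w -> w \in X) -> irreflexive e ->
  visible e X u v -> v = u \/ e u v.
Proof.
move=> enc irr [[|w p] [[/= pp lp _] hX]]; first by left.
case/andP: pp => uw _; right.
case: (hX w) => [||wu|<- //]; rewrite ?inE ?eqxx ?orbT //; first exact: enc.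
by rewrite wu irr in uw.
Qed.

Lemma dual_mutual_visibility_same (T : finType) (e : rel T) (X : {set T})
    (u v : T) :
  dual_mutual_visibility e X -> (u \in X) = (v \in X) -> visible e X u v.
Proof.
case=> hX hN; case: (boolP (v \in X)) => vX uX; first exact: hX.
by apply: hN; rewrite ?uX.
Qed.

(** * Constraints on lines and corners *)

(** Here [f] is membership in [X] along a row or column of length [L]; a member [k] blocks any
    same-class pair around it. *)
Definition line_ok (L : nat) (f : nat -> bool) :=
  forall j k l, j < k < l -> l < L -> f k -> f j != f l.

(** [i0] is an end of the line and [i1] the vertex next to it; both ends are covered, so one
    argument serves all four corners. *)
Definition end_pair (L i0 i1 : nat) :=
  (i0 == 0) && (i1 == 1) || (i0 == L.-1) && (i1 == L.-2).

Lemma line_ok_triple (L : nat) (f : nat -> bool) (j k l : nat) :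
  line_ok L f -> j < k < l -> l < L -> f j + f k + f l <= 2.
Proof.
move=> ok jkl lL; have := ok j k l jkl lL.
by case: (f j) (f k) (f l) => [] [] [] // /(_ isT).
Qed.

(** An inner member [k] separates the first two vertices from the last two, so each of these pairs
    is of one class and the classes differ. The pair in [X] then makes three members with [k], and
    its middle one blocks the other two. *)
Lemma line_ok_end (L : nat) (f : nat -> bool) (k : nat) :
  3 < L -> line_ok L f -> k < L -> f k -> k \in [:: 0; 1; L.-2; L.-1].
Proof.
move=> L4 ok kL fk; apply/negPn/negP; rewrite !inE => hk.
have h1 := ok 0 k L.-1; have h2 := ok 1 k L.-1; have h3 := ok 0 k L.-2.
have h4 := ok 0 1 k; have h5 := ok k L.-2 L.-1.
rewrite fk in h1 h2 h3 h4 h5.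
move: {h1}(h1 ltac:(lia) ltac:(lia) isT) {h2}(h2 ltac:(lia) ltac:(lia) isT).
move: {h3}(h3 ltac:(lia) ltac:(lia) isT).
move: {h4}(h4 ltac:(lia) ltac:(lia)) {h5}(h5 ltac:(lia) ltac:(lia)).
by case: (f 0); case: (f 1); case: (f L.-2); case: (f L.-1) => // h5 h4;
  move: (h5 isT) || move: (h4 isT).
Qed.

(** If [i1] is a member and the end [i0] is not, the next two vertices must be members, and then
    three consecutive members occur. *)
Lemma line_ok_end_pair (L : nat) (f : nat -> bool) (i0 i1 : nat) :
  3 < L -> line_ok L f -> end_pair L i0 i1 -> f i1 -> f i0.
Proof.
move=> L4 ok /orP [] /andP [/eqP -> /eqP ->] f1; apply/negPn/negP => f0.
  have h1 := ok 0 1 2; have h2 := ok 0 1 3; have h3 := ok 1 2 3.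
  rewrite f1 (negbTE f0) in h1 h2 h3.
  move: {h1}(h1 isT ltac:(lia) isT) {h2}(h2 isT ltac:(lia) isT).
  move: {h3}(h3 isT ltac:(lia)).
  by case: (f 2); case: (f 3) => // /(_ isT).
have h1 := ok (L - 3) L.-2 L.-1; have h2 := ok (L - 4) L.-2 L.-1.
have h3 := ok (L - 4) (L - 3) L.-2.
rewrite f1 (negbTE f0) in h1 h2 h3.
move: {h1}(h1 ltac:(lia) ltac:(lia) isT) {h2}(h2 ltac:(lia) ltac:(lia) isT).
move: {h3}(h3 ltac:(lia) ltac:(lia)).
by case: (f (L - 3)); case: (f (L - 4)) => // /(_ isT).
Qed.

(** These constraints are all that the upper bounds use. In the last one the corner has both
    neighbours in [X]; they remain in the list because they may share its class. *)
Definition pattern_ok (n m : nat) (x : nat -> nat -> bool) :=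
  [/\ forall i, i < n -> line_ok m (x i),
      forall j, j < m -> line_ok n (x^~ j) &
      forall i0 i1 j0 j1 i j, end_pair n i0 i1 -> end_pair m j0 j1 ->
        x i0 j1 -> x i1 j0 -> i < n -> j < m -> x i j = x i0 j0 ->
        (i, j) \in [:: (i0, j0); (i0, j1); (i1, j0)]].

Lemma pattern_ok_dual (n m : nat) (X : {set 'I_n.+1 * 'I_m.+1}) :
  0 < n -> 0 < m ->
  dual_mutual_visibility (@grid n.+1 m.+1) X ->
  pattern_ok n.+1 m.+1 (fun i j => (inord i, inord j) \in X).
Proof.
move=> n0 m0 dX; split.
- move=> i iN j k l jkl lM kX; apply/negP => /eqP same.
  have vis := dual_mutual_visibility_same dX same.
  move: kX; apply/negP; apply: (visible_straight vis); first by left.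
  + by rewrite /grid_dist /= !inordK; lia.
  + by case=> /(congr1 val); rewrite /= !inordK; lia.
  + by case=> /(congr1 val); rewrite /= !inordK; lia.
- move=> i iN j k l jkl lM kX; apply/negP => /eqP same.
  have vis := dual_mutual_visibility_same dX same.
  move: kX; apply/negP; apply: (visible_straight vis); first by right.
  + by rewrite /grid_dist /= !inordK; lia.
  + by case=> /(congr1 val); rewrite /= !inordK; lia.
  + by case=> /(congr1 val); rewrite /= !inordK; lia.
move=> i0 i1 j0 j1 i j ei ej X01 X10 iN jM same.
have ei' : (i0 <= n) && (i1 <= n) by move: ei; rewrite /end_pair; lia.
have ej' : (j0 <= m) && (j1 <= m) by move: ej; rewrite /end_pair; lia.
(* An end has a single neighbour on its line, so the corner has only the two neighbours assumed to
   be in [X]. *)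
have enc (w : 'I_n.+1 * 'I_m.+1) : grid (inord i0, inord j0) w -> w \in X.
  case: w => [a b]; rewrite /grid /= !inordK; try lia.
  move=> /eqP adj; have : (a = i0 :> nat /\ b = j1 :> nat) \/
                          (a = i1 :> nat /\ b = j0 :> nat).
    by move: ei ej adj (ltn_ord a) (ltn_ord b); rewrite /end_pair; lia.
  case=> [] [ea eb]; [move: X01 | move: X10]; congr (_ \in X); congr pair;
    by apply: val_inj; rewrite /= inordK; lia.
have vis := dual_mutual_visibility_same dX (esym same).
case: (visible_enclosed enc (@grid_irr _ _) vis).
  case=> /(congr1 val) + /(congr1 val); rewrite /= !inordK; try lia.
  by move=> -> ->; rewrite mem_head.
rewrite /grid /= !inordK; try lia.
by move: ei ej; rewrite /end_pair !inE !xpair_eqE; lia.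
Qed.

(** Turns a bound on [X] into arithmetic on the memberships of finitely many cells that cover
    [X]. *)
Lemma leq_card_sumn (n m : nat) (X : {set 'I_n.+1 * 'I_m.+1})
    (s : seq (nat * nat)) :
  (forall i j, i <= n -> j <= m -> (inord i, inord j) \in X -> (i, j) \in s) ->
  #|X| <= sumn [seq (((inord ij.1, inord ij.2) : 'I_n.+1 * 'I_m.+1) \in X : nat)
               | ij <- s].
Proof.
move=> cov.
pose f (ij : nat * nat) : 'I_n.+1 * 'I_m.+1 := (inord ij.1, inord ij.2).
have -> : [seq ((f ij \in X) : nat) | ij <- s] =
          map (nat_of_bool \o mem X) (map f s).
  by rewrite -map_comp.
rewrite map_comp sumn_count count_map -size_filter cardE.
apply: uniq_leq_size; first exact: enum_uniq.
move=> [a b]; rewrite mem_enum mem_filter => abX; rewrite /= abX /=.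
apply/mapP; exists (a : nat, b : nat); last by rewrite /f /= !inord_val.
by apply: cov; rewrite ?inord_val // -ltnS ltn_ord.
Qed.

(** Each vertex occurs in three of the four triples, so three times the sum is at most 8. *)
Lemma line_ok_quadruple (L : nat) (f : nat -> bool) (i j k l : nat) :
  line_ok L f -> i < j -> j < k < l -> l < L -> f i + f j + f k + f l <= 2.
Proof.
move=> ok ij jkl lL.
have := line_ok_triple ok jkl lL.
have : f i + f j + f k <= 2 by apply: (line_ok_triple ok); lia.
have : f i + f j + f l <= 2 by apply: (line_ok_triple ok); lia.
have : f i + f k + f l <= 2 by apply: (line_ok_triple ok); lia.
by lia.
Qed.

Lemma pattern_ok_corner (n m : nat) (x : nat -> nat -> bool)
    (i0 i1 j0 j1 i j : nat) :
  pattern_ok n m x -> end_pair n i0 i1 -> end_pair m j0 j1 -> i < n -> j < m ->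
  (i, j) \notin [:: (i0, j0); (i0, j1); (i1, j0)] ->
  x i0 j0 + x i0 j1 + x i1 j0 + x i j <= 3.
Proof.
case=> _ _ corner ei ej iN jM; apply: contraR => h.
apply: (corner _ _ _ _ _ _ ei ej) => //; move: h;
  by case: (x i0 j0); case: (x i0 j1); case: (x i1 j0); case: (x i j).
Qed.

(** A member diagonal to a corner would force the neighbours of a corner, and that corner, into [X];
    then the corner cannot see the diagonal member of its own class. *)
Lemma pattern_ok_diagonal (n m : nat) (x : nat -> nat -> bool)
    (i0 i1 j0 j1 : nat) :
  pattern_ok n m x -> 3 < n -> 2 < m -> end_pair n i0 i1 -> end_pair m j0 j1 ->
  ~~ x i1 j1.
Proof.
move=> ok n4 m3 ei ej; apply/negP => x11; have [rows cols _] := ok.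
have iN : i0 < n /\ i1 < n by move: ei; rewrite /end_pair; lia.
have jM : j0 < m /\ j1 < m by move: ej; rewrite /end_pair; lia.
have x01 : x i0 j1 by apply: (line_ok_end_pair n4 (cols _ jM.2) ei).
(* For [m = 3] the cell is in the middle of its row, and the row rule puts exactly one of the two
   ends in [X]; the corner is chosen on that side. *)
have [j [ejj xj]] : exists j, end_pair m j j1 /\ x i1 j.
  have [m_eq|m_neq] := eqVneq m 3.
    have j1E : j1 = 1 by move: ej; rewrite /end_pair; lia.
    rewrite m_eq j1E in rows x11 *.
    have := rows i1 iN.2 0 1 2 isT isT x11.
    case x10 : (x i1 0); first by exists 0.
    by case x12 : (x i1 2) => // _; exists 2.
  exists j0; split=> //; apply: (line_ok_end_pair _ (rows _ iN.2) ej x11).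
  by lia.
have jm : j < m by move: ejj; rewrite /end_pair; lia.
have x0j : x i0 j by apply: (line_ok_end_pair n4 (cols _ jm) ei).
have := pattern_ok_corner ok ei ejj iN.2 jM.2.
rewrite x0j x01 xj x11 => /(_ _)/negP; apply=> //.
by move: ei ejj; rewrite /end_pair !inE !xpair_eqE; lia.
Qed.

(** * Upper bounds by counting *)

(** [c] are the corners, 1 opposite 4 and 2 opposite 3; [h] and [v] are their neighbours along rows
    and columns. Adding the four sides counts corners twice: [C] corners and [N] neighbours satisfy
    [2C + N <= 8], so three corners leave at most 5. With two corners, 6 would need all their
    neighbours, which a common side or the opposite-corner bound excludes. One corner gives at most
    3. *)
Lemma corner_count_wide (c1 c2 c3 c4 h1 h2 h3 h4 v1 v2 v3 v4 : bool) :
  v1 <= c1 -> v2 <= c2 -> v3 <= c3 -> v4 <= c4 ->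
  h1 <= c1 -> h2 <= c2 -> h3 <= c3 -> h4 <= c4 ->
  c1 + v1 + v3 + c3 <= 2 -> c2 + v2 + v4 + c4 <= 2 ->
  c1 + h1 + h2 + c2 <= 2 -> c3 + h3 + h4 + c4 <= 2 ->
  c1 + h1 + v1 + c4 <= 3 -> c2 + h2 + v2 + c3 <= 3 ->
  c3 + h3 + v3 + c2 <= 3 -> c4 + h4 + v4 + c1 <= 3 ->
  c1 + (h1 + (v1 + (c2 + (h2 + (v2 + (c3 + (h3 + (v3 + (c4 + (h4 + v4))))))))))
    <= 5.
Proof.
by case: c1; case: c2; case: c3; case: c4; case: h1 => //; case: h2 => //;
  case: h3 => //; case: h4 => //; case: v1 => //; case: v2 => //;
  case: v3 => //; case: v4.
Qed.

(** [t] and [b] are the middles of the short sides. The long sides give at most 4, so 6 needs [t],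
    [b] and two members on each long side. The single corners beside [t] and [b] are then opposite,
    since a long side without corners is empty, and each has both neighbours in [X], which is
    excluded. *)
Lemma corner_count_narrow (c1 c2 c3 c4 t b v1 v2 v3 v4 : bool) :
  v1 <= c1 -> v2 <= c2 -> v3 <= c3 -> v4 <= c4 ->
  c1 + v1 + v3 + c3 <= 2 -> c2 + v2 + v4 + c4 <= 2 ->
  (t -> c1 != c2) -> (b -> c3 != c4) ->
  c1 + t + v1 + c4 <= 3 -> c2 + t + v2 + c3 <= 3 ->
  c3 + b + v3 + c2 <= 3 -> c4 + b + v4 + c1 <= 3 ->
  c1 + (t + (c2 + (v1 + (v2 + (c3 + (b + (c4 + (v3 + v4)))))))) <= 5.
Proof.
by case: c1; case: c2; case: c3; case: c4; case: t => //; case: b => //;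
  case: v1 => //; case: v2 => //; case: v3 => //; case: v4 => // _ _ _ _ _ _
  /(_ isT).
Qed.

Lemma nat_of_bool_leq (b c : bool) : (b -> c) -> b <= c.
Proof. by case: b => // ->. Qed.

(** The end rule in both directions leaves sixteen cells around the corners; the four diagonal ones
    are excluded, and twelve remain to be counted. *)
Lemma card_le_5_wide (n m : nat) (X : {set 'I_n.+1 * 'I_m.+1}) :
  2 < n -> 2 < m -> dual_mutual_visibility (@grid n.+1 m.+1) X -> #|X| <= 5.
Proof.
move=> n3 m3 dX.
have n4 : 3 < n.+1 := n3; have m4 : 3 < m.+1 := m3.
have ok := pattern_ok_dual (ltnW (ltnW n3)) (ltnW (ltnW m3)) dX.
pose x i j := ((inord i, inord j) : 'I_n.+1 * 'I_m.+1) \in X.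
rewrite -/x in ok; have [rows cols _] := ok.
apply: leq_trans (@leq_card_sumn n m X
  [:: (0, 0); (0, 1); (1, 0); (0, m); (0, m.-1); (1, m);
      (n, 0); (n, 1); (n.-1, 0); (n, m); (n, m.-1); (n.-1, m)] _) _.
  move=> i j iN jM; rewrite -/(x i j) => xij.
  have hj := @line_ok_end m.+1 _ _ m3 (rows i iN) jM xij.
  have hi := @line_ok_end n.+1 _ _ n3 (cols j jM) iN xij.
  apply: contraT => nin.
  have [i0 [j0 [ei ej]]] :
      exists i0 j0, end_pair n.+1 i0 i /\ end_pair m.+1 j0 j.
    move: hi hj nin; rewrite !inE !xpair_eqE.
    case/or4P=> /eqP ->; case/or4P=> /eqP ->; rewrite !eqxx ?orbT //= => _;
      [exists 0, 0 | exists 0, m | exists n, 0 | exists n, m];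
      by rewrite /end_pair !eqxx ?orbT.
  by have := pattern_ok_diagonal ok n3 (ltnW m3) ei ej; rewrite xij.
rewrite /= addn0 -!/(x _ _).
have e0 : end_pair n.+1 0 1 by [].
have en : end_pair n.+1 n n.-1 by rewrite /end_pair /= !eqxx orbT.
have f0 : end_pair m.+1 0 1 by [].
have fm : end_pair m.+1 m m.-1 by rewrite /end_pair /= !eqxx orbT.
(* The cell [(i, j)] is the corner opposite to [(i0, j0)]. *)
have far i0 i1 j0 j1 i j : (i0, j0, i, j) \in
    [:: (0, 0, n, m); (0, m, n, 0); (n, 0, 0, m); (n, m, 0, 0)] ->
    end_pair n.+1 i0 i1 -> end_pair m.+1 j0 j1 ->
    x i0 j0 + x i0 j1 + x i1 j0 + x i j <= 3.
  rewrite !inE !xpair_eqE => pos ei ej.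
  apply: (pattern_ok_corner ok ei ej).
  - by move: pos; lia.
  - by move: pos; lia.
  by move: pos ei ej; rewrite /end_pair !inE !xpair_eqE; lia.
have := far _ _ _ _ n m _ e0 f0; have := far _ _ _ _ n 0 _ e0 fm.
have := far _ _ _ _ 0 m _ en f0; have := far _ _ _ _ 0 0 _ en fm.
rewrite !inE !eqxx ?orbT => /(_ isT) k4 /(_ isT) k3 /(_ isT) k2 /(_ isT) k1.
have v1 : x 1 0 <= x 0 0 :=
  nat_of_bool_leq (line_ok_end_pair n4 (cols 0 isT) e0).
have v2 : x 1 m <= x 0 m :=
  nat_of_bool_leq (line_ok_end_pair n4 (cols m (leqnn _)) e0).
have v3 : x n.-1 0 <= x n 0 :=
  nat_of_bool_leq (line_ok_end_pair n4 (cols 0 isT) en).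
have v4 : x n.-1 m <= x n m :=
  nat_of_bool_leq (line_ok_end_pair n4 (cols m (leqnn _)) en).
have h1 : x 0 1 <= x 0 0 :=
  nat_of_bool_leq (line_ok_end_pair m4 (rows 0 isT) f0).
have h2 : x n 1 <= x n 0 :=
  nat_of_bool_leq (line_ok_end_pair m4 (rows n (leqnn _)) f0).
have h3 : x 0 m.-1 <= x 0 m :=
  nat_of_bool_leq (line_ok_end_pair m4 (rows 0 isT) fm).
have h4 : x n m.-1 <= x n m :=
  nat_of_bool_leq (line_ok_end_pair m4 (rows n (leqnn _)) fm).
have colsum j : j < m.+1 -> x 0 j + x 1 j + x n.-1 j + x n j <= 2.
  by move=> jm; apply: (line_ok_quadruple (cols j jm)); move: n3; clear; lia.
have rowsum i : i < n.+1 -> x i 0 + x i 1 + x i m.-1 + x i m <= 2.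
  by move=> im; apply: (line_ok_quadruple (rows i im)); move: m3; clear; lia.
have c1 := colsum 0 isT; have c2 := colsum m (leqnn _).
have r1 := rowsum 0 isT; have r2 := rowsum n (leqnn _).
exact: corner_count_wide.
Qed.

(* When [m = 3] the middle cells of the two short sides are adjacent to two
   corners each, so the bound needs its own count. *)
Lemma card_le_5_narrow (n : nat) (X : {set 'I_n.+1 * 'I_3}) :
  2 < n -> dual_mutual_visibility (@grid n.+1 3) X -> #|X| <= 5.
Proof.
move=> n3 dX.
have n4 : 3 < n.+1 := n3.
have ok := pattern_ok_dual (m := 2) (ltnW (ltnW n3)) isT dX.
pose x i j := ((inord i, inord j) : 'I_n.+1 * 'I_3) \in X.
rewrite -/x in ok; have [rows cols _] := ok.
apply: leq_trans (@leq_card_sumn n 2 X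
  [:: (0, 0); (0, 1); (0, 2); (1, 0); (1, 2);
      (n, 0); (n, 1); (n, 2); (n.-1, 0); (n.-1, 2)] _) _.
  move=> i j iN jM; rewrite -/(x i j) => xij.
  have hi := @line_ok_end n.+1 _ _ n3 (cols j jM) iN xij.
  apply: contraT => nin.
  have [i0 ei] : exists i0, end_pair n.+1 i0 i.
    move: hi jM nin; rewrite !inE !xpair_eqE.
    case/or4P=> /eqP -> /=; case: j {xij} => [|[|[|//]]];
      rewrite ?eqxx ?orbT //=;
      by [exists 0 | exists n; rewrite /end_pair !eqxx ?orbT].
  (* A member outside the ten listed cells would be in the middle column next to a short side, which
     is a diagonal position. *)
  have j1 : j = 1.
    move: hi jM nin; rewrite !inE !xpair_eqE.
    by case/or4P=> /eqP -> /=; case: j {xij} => [|[|[|//]]];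
      rewrite ?eqxx ?orbT.
  have := @pattern_ok_diagonal _ 3 _ _ _ 0 1 ok n3 isT ei isT.
  by rewrite -j1 xij.
rewrite /= addn0 -!/(x _ _).
have e0 : end_pair n.+1 0 1 by [].
have en : end_pair n.+1 n n.-1 by rewrite /end_pair /= !eqxx orbT.
have f0 : end_pair 3 0 1 by [].
have fm : end_pair 3 2 1 by [].
have far i0 i1 j0 j1 i j : (i0, j0, i, j) \in
    [:: (0, 0, n, 2); (0, 2, n, 0); (n, 0, 0, 2); (n, 2, 0, 0)] ->
    end_pair n.+1 i0 i1 -> end_pair 3 j0 j1 ->
    x i0 j0 + x i0 j1 + x i1 j0 + x i j <= 3.
  rewrite !inE !xpair_eqE => pos ei ej.
  apply: (pattern_ok_corner ok ei ej).
  - by move: pos; lia.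
  - by move: pos; lia.
  by move: pos ei ej; rewrite /end_pair !inE !xpair_eqE; lia.
have := far _ _ _ _ n 2 _ e0 f0; have := far _ _ _ _ n 0 _ e0 fm.
have := far _ _ _ _ 0 2 _ en f0; have := far _ _ _ _ 0 0 _ en fm.
rewrite !inE !eqxx ?orbT => /(_ isT) k4 /(_ isT) k3 /(_ isT) k2 /(_ isT) k1.
have v1 : x 1 0 <= x 0 0 :=
  nat_of_bool_leq (line_ok_end_pair n4 (cols 0 isT) e0).
have v2 : x 1 2 <= x 0 2 :=
  nat_of_bool_leq (line_ok_end_pair n4 (cols 2 isT) e0).
have v3 : x n.-1 0 <= x n 0 :=
  nat_of_bool_leq (line_ok_end_pair n4 (cols 0 isT) en).
have v4 : x n.-1 2 <= x n 2 :=
  nat_of_bool_leq (line_ok_end_pair n4 (cols 2 isT) en).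
have colsum j : j < 3 -> x 0 j + x 1 j + x n.-1 j + x n j <= 2.
  by move=> jm; apply: (line_ok_quadruple (cols j jm)); move: n3; clear; lia.
have c1 := colsum 0 isT; have c2 := colsum 2 isT.
have r1 := rows 0 isT 0 1 2 isT isT; have r2 := rows n (leqnn _) 0 1 2 isT isT.
exact: corner_count_narrow.
Qed.

(** Lines of three vertices are too short for the end rule, so all nine memberships are examined. *)
Lemma card_le_4_square (X : {set 'I_3 * 'I_3}) :
  dual_mutual_visibility (@grid 3 3) X -> #|X| <= 4.
Proof.
move=> dX; have ok := pattern_ok_dual (n := 2) (m := 2) isT isT dX.
pose x i j := ((inord i, inord j) : 'I_3 * 'I_3) \in X.
rewrite -/x in ok; have [rows cols corner] := ok.
apply: leq_trans (@leq_card_sumn 2 2 X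
  [:: (0, 0); (0, 1); (0, 2); (1, 0); (1, 1); (1, 2);
      (2, 0); (2, 1); (2, 2)] _) _.
  by move=> i j iN jM _; rewrite !inE !xpair_eqE; lia.
rewrite /= addn0 -!/(x _ _).
have r0 := rows 0 isT 0 1 2 isT isT; have r1 := rows 1 isT 0 1 2 isT isT.
have r2 := rows 2 isT 0 1 2 isT isT.
have c0 := cols 0 isT 0 1 2 isT isT; have c1 := cols 1 isT 0 1 2 isT isT.
have c2 := cols 2 isT 0 1 2 isT isT.
have far i0 j0 i j : i0 != 1 -> j0 != 1 -> i0 < 3 -> j0 < 3 -> i < 3 -> j < 3 ->
    (i, j) \notin [:: (i0, j0); (i0, 1); (1, j0)] ->
    x i0 1 -> x 1 j0 -> x i j <> x i0 j0.
  move=> hi hj hi' hj' iN jM nin x1 x2 e; move/negP: nin; apply.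
  by apply: (corner i0 1 j0 1) => //;
    move: hi hj hi' hj'; rewrite /end_pair /=; clear; lia.
(* Each corner is tested against two cells that it could not see. *)
have k1 := far 0 0 1 1 isT isT isT isT isT isT isT.
have k2 := far 0 0 1 2 isT isT isT isT isT isT isT.
have k3 := far 0 2 1 0 isT isT isT isT isT isT isT.
have k4 := far 0 2 1 1 isT isT isT isT isT isT isT.
have k5 := far 2 0 0 1 isT isT isT isT isT isT isT.
have k6 := far 2 0 0 2 isT isT isT isT isT isT isT.
have k7 := far 2 2 0 0 isT isT isT isT isT isT isT.
have k8 := far 2 2 0 1 isT isT isT isT isT isT isT.
move: r0 r1 r2 c0 c1 c2 k1 k2 k3 k4 k5 k6 k7 k8; clear.
by case: (x 0 0); case: (x 0 1); case: (x 0 2); case: (x 1 0); case: (x 1 1);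
   case: (x 1 2); case: (x 2 0); case: (x 2 1); case: (x 2 2); intuition.
Qed.

(** Each of the two columns has at most two members; a column of three vertices is counted by the
    triple bound, a longer one by its four end cells. *)
Lemma card_le_4_two_columns (n : nat) (X : {set 'I_n.+1 * 'I_2}) :
  1 < n -> dual_mutual_visibility (@grid n.+1 2) X -> #|X| <= 4.
Proof.
move=> n2 dX; have [_ cols _] := pattern_ok_dual (m := 1) (ltnW n2) isT dX.
pose x i j := ((inord i, inord j) : 'I_n.+1 * 'I_2) \in X.
have {}cols j : j < 2 -> line_ok n.+1 (x^~ j) := cols j.
have [n_eq|n_neq] := eqVneq n 2.
  apply: leq_trans (@leq_card_sumn n 1 X
    [:: (0, 0); (1, 0); (2, 0); (0, 1); (1, 1); (2, 1)] _) _.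
    by move=> i j iN jM _; rewrite !inE !xpair_eqE; lia.
  rewrite /= addn0 -!/(x _ _).
  have colsum j : j < 2 -> x 0 j + x 1 j + x 2 j <= 2.
    by move=> jm; apply: (line_ok_triple (cols j jm)); lia.
  by have := colsum 0 isT; have := colsum 1 isT; lia.
have n4 : 3 < n.+1 by lia.
apply: leq_trans (@leq_card_sumn n 1 X
  [:: (0, 0); (1, 0); (n.-1, 0); (n, 0);
      (0, 1); (1, 1); (n.-1, 1); (n, 1)] _) _.
  move=> i j iN jM; rewrite -/(x i j) => xij.
  have := line_ok_end n4 (cols j jM) iN xij.
  by rewrite !inE !xpair_eqE /=; lia.
rewrite /= addn0 -!/(x _ _).
have colsum j : j < 2 -> x 0 j + x 1 j + x n.-1 j + x n j <= 2.
  by move=> jm; apply: (line_ok_quadruple (cols j jm)); lia.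
by have := colsum 0 isT; have := colsum 1 isT; lia.
Qed.

(** If all four cells were in [X], the corner [(0, 0)] would not see [(1, 1)]. *)
Lemma card_le_3_square (X : {set 'I_2 * 'I_2}) :
  dual_mutual_visibility (@grid 2 2) X -> #|X| <= 3.
Proof.
move=> dX; have ok := pattern_ok_dual (n := 1) (m := 1) isT isT dX.
apply: leq_trans (@leq_card_sumn 1 1 X [:: (0, 0); (0, 1); (1, 0); (1, 1)] _) _.
  by move=> i j iN jM _; rewrite !inE !xpair_eqE; lia.
have := pattern_ok_corner (i0 := 0) (i1 := 1) (j0 := 0) (j1 := 1) (i := 1)
  (j := 1) ok isT isT isT isT isT.
by rewrite /= addn0 !addnA.
Qed.

(** * Bounds on [mu_d] and explicit sets *)

Lemma mu_d_leq (T : finType) (e : rel T) (k : nat) :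
  (forall X, dual_mutual_visibility e X -> #|X| <= k) -> mu_d e <= k.
Proof. by move=> h; apply/bigmax_leqP => X /asboolP; apply: h. Qed.

Definition greedy_next (s : seq (nat * nat))
    (B : nat -> nat -> nat -> nat -> bool) (c d i j : nat) :=
  (i == c) && (j == d) || ((i, j) \notin s) && ~~ B i j c d.

(** Certificate for a lower bound: [B] contains no pair of one class, and from any pair outside [B]
    one of the four unit moves towards the target is acceptable. *)
Lemma mu_d_geq_size (n m : nat) (s : seq (nat * nat))
    (B : nat -> nat -> nat -> nat -> bool) :
  uniq s -> all (fun ij => (ij.1 < n) && (ij.2 < m)) s ->
  (forall a b c d, a < n -> b < m -> c < n -> d < m ->
     ((a, b) \in s) = ((c, d) \in s) -> ~~ B a b c d) ->
  (forall a b c d, a < n -> b < m -> c < n -> d < m ->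
     (a != c) || (b != d) -> ~~ B a b c d ->
     [|| (a < c) && greedy_next s B c d a.+1 b,
         (c < a) && greedy_next s B c d a.-1 b,
         (b < d) && greedy_next s B c d a b.+1 |
         (d < b) && greedy_next s B c d a b.-1]) ->
  size s <= mu_d (@grid n m).
Proof.
move=> us range same step.
pose X := [set u : 'I_n * 'I_m | (val u.1, val u.2) \in s].
have Xx (u : 'I_n * 'I_m) : (u \in X) = ((val u.1, val u.2) \in s).
  by rewrite inE.
have vis (u v : 'I_n * 'I_m) :
    (u \in X) = (v \in X) -> visible (@grid n m) X u v.
  rewrite !Xx => uv.
  apply: (@visible_of_greedy_nat n m (fun i j => (i, j) \in s) B X Xx);
    last first.
    exact: same.
  move=> a b c d aN bM cN dM neq nB.
  have /(step _ _ _ _ aN bM cN dM) /(_ nB) /= : (a != c) || (b != d).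
    by rewrite -negb_and -xpair_eqE; apply/eqP.
  have goodP i j : greedy_next s B c d i j ->
      i = c /\ j = d \/ ((i, j) \notin s) && ~~ B i j c d.
    by case/orP; [case/andP=> /eqP -> /eqP ->; left | right].
  case/or4P=> /andP [lt /goodP good].
  - by exists a.+1, b; split=> //; lia.
  - by exists a.-1, b; split=> //; lia.
  - by exists a, b.+1; split=> //; lia.
  by exists a, b.-1; split=> //; lia.
have dX : dual_mutual_visibility (@grid n m) X.
  split=> u v uX vX; apply: vis; first by rewrite uX vX.
  by rewrite (negbTE uX) (negbTE vX).
apply: leq_trans (leq_bigmax_cond X _); last exact/asboolP.
rewrite cardE -(size_map (fun u : 'I_n * 'I_m => (val u.1, val u.2))).
apply: uniq_leq_size us _ => -[i j] ijs.
have /andP [/ord_lift [a ia] /ord_lift [b jb]] := allP range _ ijs.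
by apply/mapP; exists (a, b); rewrite ?mem_enum ?Xx /= ?ia ?jb.
Qed.

Lemma mu_d_square_geq : 3 <= mu_d (@grid 2 2).
Proof.
(* The exceptional pair is [(0, 0)] and [(1, 1)], one inside the set and one outside. *)
pose B (a b c d : nat) := (a == b) && (c == d) && (a != c).
change (size [:: (0, 0); (0, 1); (1, 0)] <= mu_d (@grid 2 2)).
apply: (@mu_d_geq_size _ _ _ B) => //;
  by move=> [|[|?]] [|[|?]] [|[|?]] [|[|?]].
Qed.

(** With the four corners as [X] every pair is visible, so [B] is empty. *)
Lemma mu_d_geq_4 (n m : nat) : 1 < n -> 0 < m -> 4 <= mu_d (@grid n.+1 m.+1).
Proof.
move=> n2 m1.
change (size [:: (0, 0); (0, m); (n, 0); (n, m)] <= mu_d (@grid n.+1 m.+1)).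
apply: (@mu_d_geq_size _ _ _ (fun _ _ _ _ => false)) => //=.
- by rewrite !inE !xpair_eqE; lia.
- by lia.
move=> a b c d aN bM cN dM neq _.
rewrite /greedy_next !andbT !inE !xpair_eqE.
by case: (ltngtP a c) => ac; case: (ltngtP b d) => bd /=; lia.
Qed.

Ltac split_bool := repeat match goal with
  | |- is_true (_ || _) -> _ => case/orP
  | |- is_true (_ && _) -> _ => case/andP
  | |- is_true (_ == _) -> _ => move/eqP => ?
  | |- is_true (_ < _) -> _ => move=> ?
  end.

Lemma mu_d_geq_5 (n m : nat) : 2 < n -> 1 < m -> 5 <= mu_d (@grid n.+1 m.+1).
Proof.
move=> n3 m2.
(* [column] and [row] are the only invisible pairs: a corner, and a vertex of
   its side that lies beyond the second vertex of [X] on this side. *)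
pose column a b c d := [&& a == 0, b == 0, d == 0 & 1 < c].
pose row a b c d := [&& a == n, b == m, c == n & d.+1 < m].
pose B a b c d :=
  [|| column a b c d, column c d a b, row a b c d | row c d a b].
change (size [:: (0, 0); (1, 0); (0, m); (n, m); (n, m.-1)] <=
        mu_d (@grid n.+1 m.+1)).
apply: (@mu_d_geq_size _ _ _ B).
- by rewrite /= !inE !xpair_eqE; lia.
- by rewrite /=; lia.
(* A pair in [B] joins a corner in [X] to a vertex outside [X], so its classes differ. *)
- move=> a b c d aN bM cN dM; rewrite !inE !xpair_eqE => same.
  by apply/negP; case/or4P => /and4P [/eqP ea /eqP eb /eqP ec ed];
    move: same; rewrite ea eb ec; lia.
move=> a b c d aN bM cN dM neq nB.
set good := greedy_next _ _ _ _.
have badP i j : ~~ good i j ->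
    ((i, j) \in [:: (0, 0); (1, 0); (0, m); (n, m); (n, m.-1)]) || B i j c d.
  by case/norP=> _; rewrite negb_and !negbK.
have goodP i j :
    (((i, j) \in [:: (0, 0); (1, 0); (0, m); (n, m); (n, m.-1)]) || B i j c d ->
     (i == c) && (j == d)) -> good i j.
  rewrite /good /greedy_next -negb_or.
  by case: (_ || B i j c d) => [->|_] //; rewrite orbT.
move: nB; rewrite /B !negb_or => /and4P [B1 B2 B3 B4].
rewrite /column /row in B1 B2 B3 B4 *.
(* If both coordinates differ, a blocked move in the first one determines the position enough for
   the second to be free. On a common line only one move exists, and [B1] to [B4] ensure that it is
   acceptable. *)
move: neq; case: (ltngtP a c) => ac; case: (ltngtP b d) => bd //= _;
  rewrite ?orbF.
- have [//|/badP bad] := boolP (good a.+1 b).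
  apply: goodP; move: bad; rewrite /B /column /row !inE !xpair_eqE.
  by clear B1 B2 B3 B4; split_bool; lia.
- have [//|/badP bad] := boolP (good a.+1 b).
  apply: goodP; move: bad; rewrite /B /column /row !inE !xpair_eqE.
  by clear B1 B2 B3 B4; split_bool; lia.
- by apply: goodP; rewrite /B /column /row !inE !xpair_eqE; split_bool; lia.
- have [//|/badP bad] := boolP (good a.-1 b).
  apply: goodP; move: bad; rewrite /B /column /row !inE !xpair_eqE.
  by clear B1 B2 B3 B4; split_bool; lia.
- have [//|/badP bad] := boolP (good a.-1 b).
  apply: goodP; move: bad; rewrite /B /column /row !inE !xpair_eqE.
  by clear B1 B2 B3 B4; split_bool; lia.
- by apply: goodP; rewrite /B /column /row !inE !xpair_eqE; split_bool; lia.
- by apply: goodP; rewrite /B /column /row !inE !xpair_eqE; split_bool; lia.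
- by apply: goodP; rewrite /B /column /row !inE !xpair_eqE; split_bool; lia.
Qed.

(** * The value in each case *)

Theorem theorem4p4 (n m : nat) (hm : 2 <= m) (hnm : m <= n) :
  mu_d (@grid n m) =
    if (n == 2) && (m == 2) then 3
    else if ((n == 3) && (m == 3)) || ((3 <= n) && (m == 2)) then 4
    else 5.
Proof.
(* From here on [n] and [m] are one less than the side lengths. *)
case: n m hm hnm => [|n] [|m] // m1 mn; rewrite !eqSS !ltnS in m1 mn *.
apply/eqP; rewrite eqn_leq.
have [m_eq|m_neq] := eqVneq m 1.
  rewrite m_eq {m_eq m1} in mn *; rewrite !andbT.
  have [->|n_neq] := eqVneq n 1.
    rewrite mu_d_square_geq andbT.
    by apply: mu_d_leq => X; apply: card_le_3_square.
  have n2 : 1 < n by lia.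
  rewrite n2 orbT mu_d_geq_4 // andbT.
  by apply: mu_d_leq => X; apply: card_le_4_two_columns.
rewrite !andbF orbF; have m2 : 1 < m by lia.
have [n_eq|n_neq] := eqVneq n 2.
  have -> : m = 2 by lia.
  rewrite n_eq mu_d_geq_4 // andbT.
  by apply: mu_d_leq => X; apply: card_le_4_square.
have n3 : 2 < n by lia.
rewrite mu_d_geq_5 // andbT; apply: mu_d_leq.
have [->|m_neq2] := eqVneq m 2 => X; first exact: card_le_5_narrow.
by apply: card_le_5_wide => //; lia.
Qed.
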